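(* Let $r$ be a positive integer. (i) The generating function for concave partitions with at most $r$ parts is given by $$PC_r(t)=\sum_{n=0}^\infty p_c(n,r)\,t^n=\frac{Q_r(t)}{\prod_{i=1}^r\left(1-t^{\frac{i(i+1)}{2}}\right)},$$ where $Q_r(t)$ is a polynomial with $Q_r(1)=1$ and of degree strictly smaller than $\frac{r^3}{6}+\frac{r^2}{2}+\frac{r}{3}$. (ii) The (asymptotic) proportion of concave partitions with at most $r$ parts among all partitions with at most $r$ parts is $$\lim_{n\to\infty}\frac{p_c(n,r)}{p(n,r)}=\frac{r!}{\prod_{i=1}^r\frac{i(i+1)}{2}}.$$
   Context: $\mathbb{N}=\{0,1,2,\dots\}$ and $\mathbb{Z}_+=\{1,2,3,\dots\}$. A partition is a weakly decreasing sequence $\lambda=(\lambda_1,\lambda_2,\lambda_3,\dots)$ of non-negative integers, all but finitely many of which are zero; its parts are its nonzero entries, and it is a partition of $n=\sum_i\lambda_i$. Its Ferrers diagram is $F(\lambda)=\{(i,j)\in\mathbb{N}^2 : i<\lambda_{j+1}\}$, and $I(\lambda)=\mathbb{N}^2\setminus F(\lambda)$, which is a monoid ideal of the additive monoid $\mathbb{N}^2$ (that is, $I(\lambda)+\mathbb{N}^2\subseteq I(\lambda)$). The integral closure of a monoid ideal $I\subseteq\mathbb{N}^2$ is $\bar I=\{\mathbf{a}\in \mathbb{N}^2 : \ell\mathbf{a}\in I \text{ for some } \ell\in\mathbb{Z}_+\}$ where, for this definition, the condition $\ell\mathbf{a}\in I$ is understood as $\ell\mathbf{a}\in \ell I:=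 I+\dots+I$ ($\ell$ summands), so that $\bar I$ equals $\mathrm{conv}_{\mathbb{Q}}(I)\cap\mathbb{N}^2$, with $\mathrm{conv}_{\mathbb{Q}}(I)$ the convex hull of $I$ in $\mathbb{Q}^2$; $I$ is integrally closed if $I=\bar I$. A partition $\lambda$ is called concave if $I(\lambda)$ is integrally closed. $p_c(n,r)$ denotes the number of concave partitions of $n$ with at most $r$ parts, and $p(n,r)$ the number of all partitions of $n$ with at most $r$ parts. *)

(* Defs.v *)
From HB Require Import structures.
From mathcomp Require Import all_boot all_order all_algebra finmap.
From mathcomp Require Import all_classical all_reals all_analysis.

Set Implicit Arguments.
Unset Strict Implicit.
Unset Printing Implicit Defensive.

Import Order.TTheory GRing.Theory Num.Theory.
Import numFieldNormedType.Exports.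

Local Open Scope classical_set_scope.
Local Open Scope ring_scope.

(* The sequence (lambda_1, lambda_2, ...) is represented by l : nat -> nat with
   l i = lambda_(i+1); thus F(lambda) = {(i, j) | i < l j}. *)
Definition partition : set (nat -> nat) :=
  [set l | (forall i, l i.+1 <= l i)%N /\ finite_set [set i | l i <> 0%N]].

(* The big operator defaults to 0 on infinite supports, which partitions exclude. *)
Definition weight (l : nat -> nat) : nat := \sum_(i \in [set: nat]) l i.

Definition nb_parts (l : nat -> nat) : nat :=
  #|` fset_set [set i | l i <> 0%N]|.

Definition ferrers (l : nat -> nat) : set (nat * nat) :=
  [set a | (a.1 < l a.2)%N].

Definition ideal_of (l : nat -> nat) : set (nat * nat) := ~` ferrers l.

(* k I = I + ... + I (k summands) *)
Definition nfold_sum (k : nat) (I : set (nat * nat)) : set (nat * nat) :=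
  [set a | exists2 x : 'I_k -> nat * nat,
             (forall i, I (x i)) & a = \sum_(i < k) x i].

Definition integral_closure (I : set (nat * nat)) : set (nat * nat) :=
  [set a | exists2 k : nat, (0 < k)%N & nfold_sum k I (a *+ k)].

Definition integrally_closed (I : set (nat * nat)) : Prop :=
  I = integral_closure I.

Definition concave (l : nat -> nat) : Prop := integrally_closed (ideal_of l).

Definition partitions (n r : nat) : set (nat -> nat) :=
  [set l | [/\ partition l, weight l = n & (nb_parts l <= r)%N]].

Definition concave_partitions (n r : nat) : set (nat -> nat) :=
  partitions n r `&` [set l | concave l].

(* fset_set returns the empty set on infinite sets; the sets used here are
   finite, see finite_partitions and finite_concave_partitions below. *)
Definition num_partitions (n r : nat) : nat := #|` fset_set (partitions n r)|.

Definition num_concave_partitions (n r : nat) : nat := #|` fset_set (concave_partitions n r)|.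

Lemma partition_le (l : nat -> nat) i j :
  partition l -> (i <= j)%N -> (l j <= l i)%N.
Proof.
case=> dl _; elim: j => [|j IHj]; first by rewrite leqn0 => /eqP ->.
rewrite leq_eqVlt => /orP[/eqP -> //|]; rewrite ltnS => /IHj.
exact: leq_trans (dl j).
Qed.

Lemma nb_parts_le (l : nat -> nat) r i :
  partition l -> (nb_parts l <= r)%N -> (r <= i)%N -> l i = 0%N.
Proof.
move=> pl lr ri; apply/eqP/negPn/negP => li0; have := lr.
rewrite leqNgt => /negP; apply.
have fl := pl.2.
have sub : ([fset val j | j in [set: 'I_r.+1]%SET]
            `<=` fset_set [set i | l i <> 0%N])%fset.
  apply/fsubsetP => _ /imfsetP[j _ ->]; rewrite in_fset_set// inE /=.
  apply/eqP; rewrite -lt0n; apply: leq_trans (partition_le pl _); last first.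
    exact: leq_trans (ltn_ord j : (j <= r)%N) ri.
  by rewrite lt0n.
apply: leq_trans (fsubset_leq_card sub).
rewrite card_imfset /=; last exact: val_inj.
by rewrite -cardE cardsT card_ord.
Qed.

Lemma le_weight (l : nat -> nat) i : partition l -> (l i <= weight l)%N.
Proof.
move=> [_ fl]; rewrite /weight.
have [-> //|li0] := eqVneq (l i) 0%N.
rewrite -(fsbig_widen [set i | l i <> 0%N])//; last first.
  by move=> j /= [_ /contrapT].
rewrite fsbig_finite//= (big_fsetD1 i) /=; first exact: leq_addr.
by rewrite in_fset_set// inE; apply/eqP.
Qed.

Lemma finite_partitions n r : finite_set (partitions n r).
Proof.
pose F (f : {ffun 'I_r -> 'I_n.+1}) (i : nat) : nat :=
  if insub i is Some j then f j else 0%N.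
apply: (@sub_finite_set _ _ (range F)); last first.
  by apply: finite_image; exact: finite_finset.
move=> l [pl wl rl]; exists [ffun j : 'I_r => inord (l j)] => //.
apply/funext => i; rewrite /F; case: insubP => [j _ ji|].
  by rewrite ffunE inordK ?ji// ltnS -wl le_weight.
by rewrite -leqNgt => /(nb_parts_le pl rl) ->.
Qed.

Lemma finite_concave_partitions n r : finite_set (concave_partitions n r).
Proof. by apply: finite_setIl; exact: finite_partitions. Qed.

(* R[[t]]: fcoef a n is the coefficient of t^n. *)
Record fps (R : Type) := Fps { fcoef : nat -> R }.

Lemma fps_eq (R : Type) (a b : fps R) : fcoef a =1 fcoef b -> a = b.
Proof. by case: a b => [a] [b] /= /funext ->. Qed.

HB.instance Definition _ (R : Type) := gen_eqMixin (fps R).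
HB.instance Definition _ (R : Type) := gen_choiceMixin (fps R).

Section FpsZmodule.
Variable R : zmodType.

Definition fps_zero : fps R := Fps (fun=> 0).
Definition fps_opp (a : fps R) := Fps (fun n => - fcoef a n).
Definition fps_add (a b : fps R) := Fps (fun n => fcoef a n + fcoef b n).

Fact fps_addA : associative fps_add.
Proof. by move=> a b c; apply: fps_eq => n /=; rewrite addrA. Qed.
Fact fps_addC : commutative fps_add.
Proof. by move=> a b; apply: fps_eq => n /=; rewrite addrC. Qed.
Fact fps_add0 : left_id fps_zero fps_add.
Proof. by move=> a; apply: fps_eq => n /=; rewrite add0r. Qed.
Fact fps_addN : left_inverse fps_zero fps_opp fps_add.
Proof. by move=> a; apply: fps_eq => n /=; rewrite addNr. Qed.

HB.instance Definition _ :=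
  GRing.isZmodule.Build (fps R) fps_addA fps_addC fps_add0 fps_addN.
End FpsZmodule.

Section FpsRing.
Variable R : comNzRingType.

Definition fps_one : fps R := Fps (fun n => (n == 0%N)%:R).
Definition fps_mul (a b : fps R) :=
  Fps (fun n => \sum_(i < n.+1) fcoef a i * fcoef b (n - i)).

Definition fps_trunc n (a : fps R) : {poly R} := \poly_(i < n.+1) fcoef a i.

Fact fps_mulE n m (a b : fps R) : (m <= n)%N ->
  fcoef (fps_mul a b) m = (fps_trunc n a * fps_trunc n b)`_m.
Proof.
move=> mn; rewrite coefM; apply: eq_bigr => i _; rewrite !coef_poly !ltnS.
by rewrite (leq_trans _ mn) ?leq_ord// (leq_trans (leq_subr _ _) mn).
Qed.

Fact fps_mulA : associative fps_mul.
Proof.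
move=> a b c; apply: fps_eq => n.
transitivity ((fps_trunc n a * (fps_trunc n b * fps_trunc n c))`_n).
  rewrite coefM; apply: eq_bigr => i _.
  by rewrite coef_poly ltn_ord -fps_mulE// leq_subr.
rewrite mulrA coefM; apply: eq_bigr => i _.
by rewrite coef_poly ltnS leq_subr -fps_mulE// leq_ord.
Qed.

Fact fps_mulC : commutative fps_mul.
Proof.
by move=> a b; apply: fps_eq => n; rewrite !(@fps_mulE n)// mulrC.
Qed.

Fact fps_mul1 : left_id fps_one fps_mul.
Proof.
move=> a; apply: fps_eq => n /=.
by rewrite big_ord_recl /= mul1r subn0 big1 ?addr0// => i _; rewrite mul0r.
Qed.

Fact fps_mulDl : left_distributive fps_mul (@GRing.add (fps R)).
Proof.
move=> a b c; apply: fps_eq => n /=; rewrite -big_split.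
by apply: eq_bigr => i _; rewrite mulrDl.
Qed.

Fact fps_one_neq0 : fps_one != 0.
Proof. by apply/eqP => /(congr1 (fun a => fcoef a 0))/eqP; rewrite oner_eq0. Qed.

HB.instance Definition _ := GRing.Zmodule_isComNzRing.Build (fps R)
  fps_mulA fps_mulC fps_mul1 fps_mulDl fps_one_neq0.

(* As usual for unit rings, the inverse is the identity on non-units. *)
Definition fps_unit : {pred fps R} := [pred a | `[< exists b, b * a = 1 >]].
Definition fps_inv (a : fps R) : fps R := xget a [set b | b * a = 1].

Fact fps_mulV : {in fps_unit, left_inverse 1 fps_inv *%R}.
Proof.
by move=> a /asboolP ua; rewrite /fps_inv; case: xgetP => [b -> //|]; case: ua => b ab /(_ b).
Qed.

Fact fps_unitPl (a b : fps R) : b * a = 1 -> fps_unit a.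
Proof. by move=> ba; apply/asboolP; exists b. Qed.

Fact fps_inv_out : {in [predC fps_unit], fps_inv =1 id}.
Proof.
move=> a /asboolPn ua; rewrite /fps_inv; case: xgetP => // b _ ba.
by case: ua; exists b.
Qed.

HB.instance Definition _ := GRing.ComNzRing_hasMulInverse.Build (fps R)
  fps_mulV fps_unitPl fps_inv_out.

Definition fps_of_poly (q : {poly R}) : fps R := Fps (fun n => q`_n).

Definition fps_X : fps R := fps_of_poly 'X.

Lemma coef_fps_Xn m n : fcoef (fps_X ^+ m) n = (n == m)%:R.
Proof.
elim: m n => [//|m IHm] n; rewrite exprS; case: n => [|n].
  by rewrite /= big_ord1 coefX mul0r.
rewrite /= 2!big_ord_recl /= !coefX mul0r add0r mul1r subn1 IHm eqSS.
by rewrite big1 ?addr0// => i _; rewrite coefX mul0r.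
Qed.

(* The denominators that occur are genuine units of R[[t]]. *)
Lemma fps_unit_1subXn m : (0 < m)%N -> 1 - fps_X ^+ m \is a GRing.unit.
Proof.
move=> m0; apply: (@fps_unitPl _ (Fps (fun n => (m %| n)%:R))).
rewrite mulrBr mulr1 mulrC; apply: fps_eq => n /=.
under eq_bigr do rewrite coef_fps_Xn.
have [nm|mn] := ltnP n m.
  rewrite big1 ?subr0; first by rewrite /dvdn modn_small.
  by move=> i _; rewrite ltn_eqF ?mul0r// (leq_trans (ltn_ord i)).
have mn1 : (m < n.+1)%N by [].
rewrite (bigD1 (Ordinal mn1))//= eqxx mul1r big1 => [|i /eqP im]; last first.
  by have [e|] := eqVneq (i : nat) m; rewrite ?mul0r//; case: im; exact: val_inj.
rewrite addr0 (dvdn_subl mn (dvdnn m)) subrr; case: n mn {mn1} => //.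
by rewrite leqn0 => /eqP m00; rewrite m00 in m0.
Qed.

End FpsRing.

Definition PC (r : nat) : fps int := Fps (fun n => (num_concave_partitions n r)%:Z).

(* Main.v *)
Require Import Defs.
From HB Require Import structures.
From mathcomp Require Import all_boot all_order all_algebra finmap zify ring.
From mathcomp Require Import all_classical all_reals all_analysis.

Import Order.TTheory GRing.Theory Num.Theory.
Import numFieldNormedType.Exports.

(** A partition with at most [r] parts is a function [l] on the naturals that
    vanishes from [r] on.  Let h be the largest convex function below [l].  The
    points of the ideal of [l] are those on or above the graph of [l], and
    integral closure adds the lattice points on or above the graph of h; so [l]
    is concave exactly when l(x) is the round-up of h(x) for every x.  Hence
    concave partitions correspond bijectively to the convex functions h that
    vanish from [r] on and have lattice points at 0 and at every bend
    ([staircase_concave], [staircase_onto], [staircase_inj]).  Slopes between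
    lattice points at horizontal distance at most r lie in (1/N)Z for N = r!, so
    such an h is the sum over s < r of (d_s / N) (s + 1 - x)_+ for natural
    numbers d_s.

    If d_s > 0, adding N to d_s keeps the bends at lattice points and adds the
    integral function (s + 1 - x)_+, hence adds w_s = (s + 1)(s + 2)/2 to the
    weight of the partition.  The admissible vectors d are therefore tiled by
    the orthants d + N k with d admissible, 0 <= d_s <= N, and k supported where
    d is ([num_concave_partitionsE]).  With c(d) the weight attached to d and
    supp d the set of s with d_s > 0, the generating function is the finite sum
    of t^c(d) / prod_(s in supp d) (1 - t^w_s), so that the numerator is
      Q = sum_d t^c(d) prod_(s not in supp d) (1 - t^w_s).

    At t = 1 only vectors of full support contribute; then h is integral
    everywhere, so its second differences d_s / N are integers and d_s = N for
    all s ([full_support]).  This gives Q(1) = 1.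

    For the degree, the term of d has degree at most c(d) plus the sum of the
    w_s with s not in supp d.  Comparing d_s with N on supp d shows that c(d) is
    at most the sum of w_s over supp d, and it is strictly smaller unless every
    d_s is 0 or N, because h(0) is an integer ([unsaturated_weight]).  The
    exceptional terms, each of degree w_0 + ... + w_(r-1), add up to
    prod_s (t^w_s + (1 - t^w_s)) = 1 ([sum_saturated]), so Q has degree smaller
    than that sum.

    For the limit, let w_0 = 1.  The number of solutions of
    k_0 w_0 + ... + k_m w_m = n, times m! w_0 ... w_m, lies between n^m and
    (n + w_0 + ... + w_m)^m ([num_solutions_bounds]).  With m = r - 1,
    multiplication by a numerator with Q(1) = 1 does not affect the leading
    term, so the number
    of concave partitions is asymptotic to n^m / (m! w_0 ... w_m); the number of
    all partitions, for which the weights are 1, ..., r, is asymptotic to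
    n^m / (m! r!). *)

(** * Convex piecewise linear functions and their round-ups *)

(** With [d] divided by a common denominator, these are the convex functions on
    the naturals that vanish from [r] on: [d s] is the second difference at
    [s.+1].  Truncated subtraction is the positive part. *)
Definition hinge {r : nat} (d : 'I_r -> nat) (x : nat) : nat :=
  \sum_(s < r) d s * (s.+1 - x).

Definition ceil_div (N m : nat) : nat := (m + N.-1) %/ N.

Lemma ceil_div_le N m i : 0 < N -> (ceil_div N m <= i) = (m <= i * N).
Proof. by move=> N0; rewrite -ltnS ltn_divLR// mulSn; lia. Qed.

Lemma le_ceil_div N m : 0 < N -> m <= ceil_div N m * N.
Proof. by move=> N0; rewrite -ceil_div_le. Qed.

Lemma ceil_div_mono N m m' : m <= m' -> ceil_div N m <= ceil_div N m'.
Proof. by move=> mm'; rewrite leq_div2r// leq_add2r. Qed.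

Lemma ceil_divMD N m q : 0 < N -> ceil_div N (m + q * N) = ceil_div N m + q.
Proof. by move=> N0; rewrite /ceil_div addnAC divnDMl. Qed.

Lemma ceil_divK N m : 0 < N -> N %| m -> ceil_div N m * N = m.
Proof.
move=> N0 /dvdnP[q ->]; rewrite -[in ceil_div _ _](add0n (q * N)) ceil_divMD//.
by rewrite /ceil_div divn_small// add0n prednK.
Qed.

Lemma hinge_anti {r} (d : 'I_r -> nat) x y : x <= y -> hinge d y <= hinge d x.
Proof. by move=> xy; apply: leq_sum => s _; rewrite leq_mul2l leq_sub2l ?orbT. Qed.

Lemma hinge_out {r} (d : 'I_r -> nat) x : r <= x -> hinge d x = 0.
Proof.
move=> rx; rewrite /hinge big1// => s _.
by rewrite (eqP (_ : s.+1 - x == 0)) ?muln0// subn_eq0 (leq_trans (ltn_ord s)).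
Qed.

Lemma hingeDM {r} N (d k : 'I_r -> nat) x :
  hinge (fun s => d s + k s * N) x = hinge d x + hinge k x * N.
Proof.
rewrite /hinge big_distrl -big_split/=; apply: eq_bigr => s _.
by rewrite mulnDl mulnAC.
Qed.

Lemma hinge_diff2 {r} (d : 'I_r -> nat) (s : 'I_r) :
  hinge d s + hinge d s.+2 = 2 * hinge d s.+1 + d s.
Proof.
rewrite /hinge big_distrr/= -big_split/= (bigD1 s)//= [in RHS](bigD1 s)//=.
rewrite (eq_bigr (fun i : 'I_r => 2 * (d i * (i.+1 - s.+1)))); first by lia.
move=> i /eqP ns; have {}ns : (i : nat) <> s by move=> e; exact/ns/val_inj.
by rewrite -mulnDr mulnCA; congr (_ * _); lia.
Qed.

(** It is enough to treat a single positive part (s + 1 - x)_+, for which this is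
    the subadditivity of the positive part. *)
Lemma hinge_jensen {r} (d : 'I_r -> nat) k (x : 'I_k -> nat) y :
  \sum_(i < k) x i = k * y -> k * hinge d y <= \sum_(i < k) hinge d (x i).
Proof.
move=> xy; rewrite exchange_big/= big_distrr/=; apply: leq_sum => s _.
rewrite -big_distrr/= mulnCA leq_mul2l; apply/orP; right.
rewrite mulnBr -xy leq_subLR -big_split/= -[k in k * _]card_ord -sum_nat_const.
by apply: leq_sum => i _; rewrite -leq_subLR.
Qed.

(** * Lower convex hulls of integer sequences *)

(** The bends of a function that is linear up to [k.+1] and bends there by [c],
    followed by the bends [d] of its continuation. *)
Definition prepend (k c : nat) (d : nat -> nat) (s : nat) : nat :=
  if s < k then 0 else if s == k then c else d (s - k.+1).

Lemma sum_prepend r k c d (F : nat -> nat) : k < r ->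
  \sum_(s < r) prepend k c d s * F s
  = c * F k + \sum_(s < r - k.+1) d s * F (s + k.+1).
Proof.
move=> kr; rewrite -(big_mkord xpredT (fun s => prepend k c d s * F s)).
rewrite (@big_cat_nat _ _ _ k.+1)//= big_nat_recr//= big_nat big1; last first.
  by move=> s /andP[_ sk]; rewrite /prepend sk.
rewrite (big_addn 0 r k.+1) big_mkord /prepend ltnn eqxx add0n.
congr (_ + _); apply: eq_bigr => s _.
by rewrite ltnNge gtn_eqF ?addnK ?(leq_trans _ (leq_addl _ _))// ltnW.
Qed.

Lemma hinge0E {r} (d : 'I_r -> nat) : hinge d 0 = \sum_(s < r) d s * s.+1.
Proof. by apply: eq_bigr => s _; rewrite subn0. Qed.

(** Gift wrapping: the first edge goes from 0 to a point [k.+1] for which the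
    descent from [l 0] is steepest, and the remaining edges are the hull of the
    shifted sequence.  The third conclusion and the fourth say that the hull
    lies below [l] and on chords between points of the graph of [l]; the last
    one, which bounds the initial slope of the hull, is what makes the two
    pieces fit together into a convex function. *)
Lemma lower_hull N r (l : nat -> nat) : 0 < N ->
    (forall x, r <= x -> l x = 0) ->
    (forall q, 0 < q <= r -> q %| N) ->
  exists d : nat -> nat, let H := hinge (fun s : 'I_r => d s) in
  [/\ H 0 = l 0 * N,
      forall s, s < r -> 0 < d s -> H s.+1 = l s.+1 * N,
      forall x, H x <= l x * N,
      forall x, exists a b, [/\ a <= x <= b, a < b &
        (b - a) * H x = ((b - x) * l a + (x - a) * l b) * N] &
      forall t, (forall x, l 0 * N <= l x * N + t * x) -> \sum_(s < r) d s <= t].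
Proof.
move=> N0; elim/ltn_ind: r l => r IHr l lr Nr.
have [l0|l0] := posnP (l 0).
  exists (fun=> 0) => H; have H0 x : H x = 0.
    by rewrite /H /hinge big1// => s _; rewrite mul0n.
  split => [||x|x|t _]; rewrite ?H0 ?l0 ?mul0n//; last by rewrite big1.
  exists 0, (x + r).+1.
  by rewrite l0 (lr (x + r).+1); [split; lia|lia].
have r0 : 0 < r by rewrite lt0n; apply/eqP => r0; rewrite lr ?r0 in l0.
(* N times the descent per step from 0 to [j.+1]. *)
pose sl (j : nat) := N %/ j.+1 * (l 0 - l j.+1).
have slE (j : nat) : j < r -> sl j * j.+1 = (l 0 - l j.+1) * N.
  by move=> jr; rewrite /sl mulnAC divnK ?Nr// mulnC.
have [k _ kmax] := @arg_maxnP _ (Ordinal r0) xpredT (fun j : 'I_r => sl j) isT.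
set t0 := sl k in kmax.
have t0E : t0 * k.+1 = (l 0 - l k.+1) * N by rewrite slE.
have t0le x : l 0 * N <= l x * N + t0 * x.
  case: x => [|x]; first lia.
  have [xr|rx] := ltnP x r.
    have := slE _ xr; have := kmax (Ordinal xr) isT => /= h.
    have : sl x * x.+1 <= t0 * x.+1 by rewrite leq_mul2r h orbT.
    by move=> + e; rewrite e mulnBl leq_subLR.
  have rr : r.-1 < r by rewrite prednK.
  have := slE _ rr; have := kmax (Ordinal rr) isT => /= h.
  have : sl r.-1 * r.-1.+1 <= t0 * x.+1 by rewrite leq_mul//; lia.
  by rewrite prednK// (lr r)// subn0 => hx <-; rewrite (leq_trans hx)// leq_addl.
have [|||d []] := IHr (r - k.+1) _ (fun x => l (k.+1 + x)).
- by rewrite ltn_subrL r0.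
- by move=> x hx; apply: lr; rewrite -leq_subLR.
- by move=> q /andP[q0 qr]; apply: Nr; rewrite q0 (leq_trans qr)// leq_subr.
set H := hinge _ => H0 Hd Hl Hab Hs; rewrite addn0 in H0 Hs.
set D := \sum_(s < r - k.+1) d s in Hs.
have lk : l k.+1 <= l 0.
  rewrite leqNgt; apply/negP => lt0k.
  have t00 : t0 = 0 by rewrite /t0 /sl (eqP (ltnW lt0k : l 0 - _ == 0)) muln0.
  by have := t0le r; rewrite t00 (lr r)// leqn0 muln_eq0 !gtn_eqF.
have Dt0 : D <= t0.
  apply: Hs => x; have := t0le (k.+1 + x); rewrite mulnDr t0E mulnBl.
  have : l k.+1 * N <= l 0 * N by rewrite leq_mul2r lk orbT.
  lia.
(* [D] is the initial slope of the hull of the shifted sequence. *)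
exists (prepend k (t0 - D) d) => H'.
have H'E x : H' x = (t0 - D) * (k.+1 - x)
                    + \sum_(s < r - k.+1) d s * ((s + k.+1).+1 - x).
  exact: (sum_prepend r k _ d (fun s => s.+1 - x) (ltn_ord k)).
have H'l x : x <= k.+1 -> H' x + t0 * x = l 0 * N.
  move=> xk; rewrite H'E.
  rewrite (eq_bigr (fun s : 'I_(r - k.+1) => d s * (k.+1 - x) + d s * s.+1)); last first.
    by move=> s _; rewrite -mulnDr; congr (_ * _); lia.
  rewrite big_split/= -big_distrl/= -/D -hinge0E -/H H0 addnA -mulnDl subnK//.
  have := t0E; rewrite mulnBl => t0E'.
  have : l k.+1 * N <= l 0 * N by rewrite leq_mul2r lk orbT.
  have : t0 * (k.+1 - x) + t0 * x = t0 * k.+1 by rewrite -mulnDr subnK.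
  lia.
have H'r x : H' (k.+1 + x) = H x.
  rewrite H'E (eqP (_ : _ - (_ + x) == 0)) ?subn_eq0 ?leq_addr// muln0 add0n.
  by apply: eq_bigr => s _; congr (_ * _); lia.
split.
- by have := H'l 0 isT; rewrite muln0 addn0.
- move=> s sr; rewrite /prepend; case: (ltngtP s k) => // sk; last first.
    by rewrite sk => _; have := H'r 0; rewrite addn0 => ->.
  move=> ds; have := Hd (s - k.+1); rewrite -H'r => /(_ _ ds).
  by rewrite addnS subnKC//; apply; rewrite ltn_sub2r// (leq_ltn_trans sk).
- move=> x; have [xk|kx] := leqP x k.+1; last first.
    by rewrite -(subnKC (ltnW kx)) H'r.
  by have := t0le x; rewrite -(H'l _ xk) leq_add2r.
- move=> x; have [xk|kx] := leqP x k.+1; last first.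
    rewrite -(subnKC (ltnW kx)); have [a [b [axb ab E]]] := Hab (x - k.+1).
    by exists (k.+1 + a), (k.+1 + b); rewrite H'r !subnDl !leq_add2l ltn_add2l.
  exists 0, k.+1; rewrite xk !subn0; split => //.
  have e1 := H'l _ xk; have := t0E; rewrite mulnBl => e2.
  have : l k.+1 * N <= l 0 * N by rewrite leq_mul2r lk orbT.
  move=> e3; have {e3}e2 : t0 * k.+1 + l k.+1 * N = l 0 * N by lia.
  have {}e1 : H' x = t0 * (k.+1 - x) + l k.+1 * N.
    have : t0 * x <= t0 * k.+1 by rewrite leq_mul2l xk orbT.
    by rewrite mulnBr; lia.
  rewrite mulnDl -!mulnA -e2 e1; have := subnK xk; move: (k.+1 - x) => y <-.
  by move: (l _ * N) => u; nia.
- move=> t tle; have /= := sum_prepend r k (t0 - D) d (fun=> 1) (ltn_ord k).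
  under eq_bigr do rewrite muln1.
  under [in X in _ = X -> _]eq_bigr do rewrite muln1.
  move=> ->; rewrite muln1 subnK//.
  rewrite -(@leq_pmul2r k.+1)// t0E mulnBl leq_subLR; exact: tle.
Qed.

(** * Concave partitions as rounded-up hulls *)

Definition staircase {r} (N : nat) (d : 'I_r -> nat) (x : nat) : nat :=
  ceil_div N (hinge d x).

Definition lattice_corners {r} (N : nat) (d : 'I_r -> nat) : bool :=
  (N %| hinge d 0) && [forall s, (0 < d s) ==> (N %| hinge d s.+1)].

Lemma partitionsP n r (l : nat -> nat) : partitions n r l <->
  [/\ forall i, l i.+1 <= l i, forall x, r <= x -> l x = 0
    & \sum_(x < r) l x = n].
Proof.
have wE : (forall x, r <= x -> l x = 0) -> weight l = \sum_(x < r) l x.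
  move=> l0; rewrite /weight -(fsbig_widen `I_r)//; last first.
    by move=> x /= [_ /negP]; rewrite -leqNgt; exact: l0.
  by rewrite fsbig_ord.
split=> [[pl wl rl]|[dl l0 wl]].
  have l0 x : r <= x -> l x = 0 by exact: nb_parts_le.
  by split=> //; [exact: pl.1|rewrite -wE].
have sub : ([set i | l i <> 0] `<=` `I_r)%classic.
  by move=> i /=; case: ltnP => // /l0.
have fl : finite_set [set i | l i <> 0]%classic.
  exact: sub_finite_set sub (finite_II r).
split; [by []|by rewrite wE|].
have : (fset_set [set i | l i <> 0]%classic `<=` [fset val j | j in [set: 'I_r]%SET])%fset.
  apply/fsubsetP => i; rewrite in_fset_set// inE => /sub/= ir.
  by apply/imfsetP; exists (Ordinal ir) => //=; rewrite inE.
move=> /fsubset_leq_card/leq_trans; apply.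
by rewrite card_imfset/=; [rewrite -cardE cardsT card_ord|exact: val_inj].
Qed.

Lemma fst_sum k (x : 'I_k -> nat * nat) :
  (\sum_(i < k) x i)%R.1 = \sum_(i < k) (x i).1.
Proof. exact: (big_morph _ (id1 := 0) (op1 := addn)). Qed.

Lemma snd_sum k (x : 'I_k -> nat * nat) :
  (\sum_(i < k) x i)%R.2 = \sum_(i < k) (x i).2.
Proof. exact: (big_morph _ (id1 := 0) (op1 := addn)). Qed.

Lemma pair_mulrn (a : nat * nat) k : (a *+ k)%R = (k * a.1, k * a.2).
Proof.
elim: k => [//|k IHk]; rewrite GRing.mulrS IHk.
by case: a {IHk} => a b; rewrite !mulSn.
Qed.

Lemma ideal_ofE (l : nat -> nat) a : ideal_of l a <-> l a.2 <= a.1.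
Proof. by rewrite [X in _ <-> is_true X]leqNgt; split=> /negP. Qed.

(** The ideal is given by l y <= i, so the closure condition can be read on
    coordinates. *)
Lemma concaveP (l : nat -> nat) : concave l <->
  forall k i y (x : 'I_k -> nat * nat), 0 < k -> (forall j, l (x j).2 <= (x j).1) ->
    k * i = \sum_(j < k) (x j).1 -> k * y = \sum_(j < k) (x j).2 -> l y <= i.
Proof.
split=> [cl k i y x k0 xl si sy|h].
  apply/(ideal_ofE l (i, y)); rewrite cl; exists k => //; exists x.
    by move=> j; apply/ideal_ofE.
  rewrite pair_mulrn /= si sy -fst_sum -snd_sum.
  by case: (\sum_(_ < _) _)%R.
apply/seteqP; split=> [a Ia|[i y] [k k0 [x xl]]].
  by exists 1 => //; exists (fun=> a) => //; rewrite GRing.mulr1n big_ord1.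
rewrite pair_mulrn /= => e; apply/ideal_ofE.
apply: (h k _ _ x) => //= [j||]; first exact/ideal_ofE.
  by rewrite -fst_sum -e.
by rewrite -snd_sum -e.
Qed.

Lemma staircase_concave {r} N (d : 'I_r -> nat) : 0 < N ->
  concave (staircase N d).
Proof.
move=> N0; apply/concaveP => k i y x k0 xl si sy.
rewrite ceil_div_le// -(leq_pmul2l k0) (leq_trans (hinge_jensen d _ _ _ (esym sy)))//.
rewrite mulnA si big_distrl/=; apply: leq_sum => j _.
by rewrite -ceil_div_le//; exact: xl.
Qed.

(** The point (i, x), repeated b - a times, is the sum of b - x copies of (l a, a)
    and x - a copies of (l b, b), up to an excess in the first coordinate that
    is absorbed by one of the summands. *)
Lemma concave_chord (l : nat -> nat) a b x i : concave l -> a <= x <= b -> a < b ->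
  (b - x) * l a + (x - a) * l b <= (b - a) * i -> l x <= i.
Proof.
move=> /concaveP cl axb ab le.
(* The excess, which is added to the summand of index 0. *)
pose e := (b - a) * i - ((b - x) * l a + (x - a) * l b).
pose p (j : 'I_(b - a)) := if j < b - x then (l a, a) else (l b, b).
pose q (j : 'I_(b - a)) := ((p j).1 + (if j == 0 :> nat then e else 0), (p j).2).
have s u v : \sum_(j < b - a) (if j < b - x then u else v) = (b - x) * u + (x - a) * v.
  rewrite -(big_mkord xpredT (fun j => if j < b - x then u else v)).
  rewrite (@big_cat_nat _ _ _ (b - x))//=; last lia.
  rewrite (eq_big_nat _ _ (F2 := fun=> u)); last by move=> j /andP[_ ->].
  rewrite [X in _ + X](eq_big_nat _ _ (F2 := fun=> v)); last first.
    by move=> j /andP[+ _]; rewrite leqNgt => /negbTE->.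
  by rewrite !sum_nat_const_nat subn0; congr (_ + _ * _); lia.
have ba0 : 0 < b - a by rewrite subn_gt0.
apply: (cl (b - a) i x q) => //= [j||].
- by rewrite /q /p/=; case: ifP => _ /=; lia.
- rewrite big_split/= [X in _ + X](bigD1 (Ordinal ba0))//= [X in _ + (_ + X)]big1; last first.
    by move=> j /eqP jn0; case: eqP => // j0; case: jn0; exact: val_inj.
  rewrite (eq_bigr (fun j : 'I_(b - a) => if j < b - x then l a else l b)) ?s; last first.
    by move=> j _; rewrite /p; case: ifP.
  by rewrite addn0 subnKC.
- rewrite (eq_bigr (fun j : 'I_(b - a) => if j < b - x then a else b)) ?s; last first.
    by move=> j _; rewrite /p; case: ifP.
  have [e1 e2 e3] : [/\ b - a = (b - x) + (x - a), x = a + (x - a)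
    & b = a + (x - a) + (b - x)] by split; lia.
  rewrite e1; move: (b - x) (x - a) e2 e3 {e p q s e1 le ba0} => v u; nia.
Qed.

Lemma staircase_partition {r} N (d : 'I_r -> nat) :
  partitions (\sum_(x < r) staircase N d x) r (staircase N d).
Proof.
apply/partitionsP; split=> // [i|x rx].
  exact/ceil_div_mono/hinge_anti.
rewrite /staircase hinge_out// /ceil_div add0n.
by case: N => // N; rewrite divn_small.
Qed.

(** The lower hull of [l] works: a lattice point above the hull is above a chord,
    so it belongs to the integral closure, that is, to the ideal itself.  All
    denominators of slopes divide [r`!]. *)
Lemma staircase_onto r (l : nat -> nat) : concave l ->
  (forall x, r <= x -> l x = 0) ->
  exists2 d : 'I_r -> nat, lattice_corners r`! d & staircase r`! d = l.
Proof.
move=> cl l0; set N := r`!; have N0 : 0 < N by exact: fact_gt0.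
have [q /dvdn_fact //|d [H0 Hd Hl Hab _]] := lower_hull N r l N0 l0.
exists (fun s : 'I_r => d s).
  rewrite /lattice_corners H0 dvdn_mull//=; apply/forallP => s; apply/implyP => ds.
  by rewrite Hd// dvdn_mull.
apply/funext => x; apply/eqP; rewrite eqn_leq ceil_div_le// Hl/=.
have [a [b [axb ab E]]] := Hab x; apply: (concave_chord l a b) => //.
rewrite -(@leq_pmul2r N)// -E -mulnA leq_mul2l; apply/orP; right.
exact: le_ceil_div.
Qed.

(** A convex function below the lattice points at the corners of another one is
    below that one everywhere: their difference is convex where the second
    function has no bend, so once it becomes positive it keeps growing, whereas
    it vanishes at [r]. *)
Lemma hinge_le {r} N (d e : 'I_r -> nat) : 0 < N ->
  (forall x, hinge d x <= staircase N e x * N) ->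
  lattice_corners N e -> forall x, hinge d x <= hinge e x.
Proof.
move=> N0 le /andP[e0 /forallP ec].
have le0 : hinge d 0 <= hinge e 0 by rewrite -(ceil_divK N (hinge e 0)).
move=> x; rewrite leqNgt; apply/negP => ltx.
(* The first point where the difference is positive; it increases from there on. *)
have [[|y] lty ymin] := ex_minnP (ex_intro (fun x => hinge e x < hinge d x) x ltx).
  by rewrite ltnNge le0 in lty.
have grow z : hinge e (y + z).+1 < hinge d (y + z).+1 /\
    hinge d (y + z) + hinge e (y + z).+1 < hinge e (y + z) + hinge d (y + z).+1.
  elim: z => [|z [IH1 IH2]].
    rewrite addn0; split=> //; have : hinge d y <= hinge e y; last lia.
    by rewrite leqNgt; apply/negP => /ymin; rewrite ltnn.
  have zr : y + z < r.
    by rewrite ltnNge; apply/negP => rz; move: IH1; rewrite !hinge_out ?leqW.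
  have ez : e (Ordinal zr) = 0.
    apply/eqP/negPn/negP; rewrite -lt0n => ez; have /implyP/(_ ez) dv := ec (Ordinal zr).
    by have := le (y + z).+1; rewrite /staircase ceil_divK// leqNgt IH1.
  have := hinge_diff2 d (Ordinal zr); have := hinge_diff2 e (Ordinal zr).
  by rewrite ez /= addnS; lia.
by have [] := grow r; rewrite !hinge_out// ?leqW// leq_addl.
Qed.

(** The corners are lattice points, so rounding up does not change them, and each
    of the two functions is the largest convex function below the staircase. *)
Lemma staircase_inj {r} N (d e : 'I_r -> nat) : 0 < N ->
  lattice_corners N d -> lattice_corners N e ->
  staircase N d = staircase N e -> d =1 e.
Proof.
move=> N0 cd ce de; have H x : hinge d x = hinge e x.
  apply/eqP; rewrite eqn_leq; apply/andP.
  by split; apply: (hinge_le N) => // y; [rewrite -de|rewrite de]; exact: le_ceil_div.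
by move=> s; have := hinge_diff2 d s; have := hinge_diff2 e s; rewrite !H; lia.
Qed.

Lemma lattice_cornersDM {r} N (d k : 'I_r -> nat) :
  (forall s, 0 < k s -> 0 < d s) ->
  lattice_corners N (fun s => d s + k s * N) = lattice_corners N d.
Proof.
move=> kd; rewrite /lattice_corners hingeDM dvdn_addl ?dvdn_mull//.
congr (_ && _); apply: eq_forallb => s.
rewrite hingeDM dvdn_addl ?dvdn_mull//; congr (_ ==> _).
have [->|/kd] := posnP (k s); first by rewrite addn0.
by move=> ds; rewrite ds addn_gt0 ds.
Qed.

(** The sum over x of the positive parts (s + 1 - x)_+. *)
Definition hinge_weight (s : nat) := (s.+1 * s.+2)./2.
Arguments hinge_weight : simpl never.

Lemma sum_hinge {r} (k : 'I_r -> nat) :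
  \sum_(x < r) hinge k x = \sum_(s < r) k s * hinge_weight s.
Proof.
rewrite exchange_big/=; apply: eq_bigr => s _; rewrite -big_distrr/=; congr (_ * _).
have -> : hinge_weight s = 'C(s.+2, 2) by rewrite bin2 mulnC.
rewrite -bin2_sum -(big_mkord xpredT (fun x => s.+1 - x)) (@big_cat_nat _ _ _ s.+1)//=.
rewrite [X in _ + X]big_nat [X in _ + X]big1 ?addn0; last first.
  by move=> x /andP[sx _]; apply/eqP; rewrite subn_eq0.
rewrite big_nat_rev/= add0n !big_mkord.
rewrite [RHS]big_ord_recl add0n; apply: eq_bigr => x _; rewrite lift0; have := ltn_ord x; lia.
Qed.

Definition staircase_weight {r} N (d : 'I_r -> nat) := \sum_(x < r) staircase N d x.

Lemma staircase_weightDM {r} N (d k : 'I_r -> nat) : 0 < N ->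
  staircase_weight N (fun s => d s + k s * N)
  = staircase_weight N d + \sum_(s < r) k s * hinge_weight s.
Proof.
move=> N0; rewrite -sum_hinge -big_split/=; apply: eq_bigr => x _.
by rewrite /staircase hingeDM ceil_divMD.
Qed.

Lemma digit_unique N d d' k k' : 0 < N -> d <= N -> d' <= N ->
  (0 < k -> 0 < d) -> (0 < k' -> 0 < d') ->
  d + k * N = d' + k' * N -> d = d' /\ k = k'.
Proof.
move=> N0 dN d'N kd kd' e.
have [kk'|kk'|kk'] := ltngtP k k'; last by split=> //; move: e; rewrite kk'; lia.
  by have := leq_mul kk' (leqnn N); rewrite mulSn; have := kd' (leq_ltn_trans _ kk'); lia.
by have := leq_mul kk' (leqnn N); rewrite mulSn; have := kd (leq_ltn_trans _ kk'); lia.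
Qed.

(** * Counting solutions of a linear equation by power series *)

Lemma card_fset_set_image {T : finType} {U : choiceType} (B : {set T}) (f : T -> U)
    (A : set U) :
  {in B &, injective f} -> (forall x, x \in B -> A (f x)) ->
  (forall y, A y -> exists2 x, x \in B & f x = y) -> #|` fset_set A| = #|B|.
Proof.
move=> fi fA fs.
have -> : (A = [set` [fset f x | x in B]%fset])%classic.
  apply/seteqP; split=> [y /fs[x xB <-]|y /imfsetP[x /= xB ->]]; last exact: fA.
  by apply/imfsetP; exists x.
by rewrite set_fsetK card_in_imfset//= -cardE.
Qed.

(** The bound [M] on the entries only serves to make the type finite; it is
    harmless as soon as the weights are positive and [n <= M]. *)
Definition supported_solutions {r} (w : 'I_r -> nat) (M : nat) (P : pred 'I_r) (c n : nat) :
    {set {ffun 'I_r -> 'I_M.+1}} :=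
  [set k : {ffun 'I_r -> 'I_M.+1} |
    [forall s, (0 < k s) ==> P s] && (c + \sum_(s < r) k s * w s == n)].

Section InverseProducts.
Local Open Scope ring_scope.

Lemma fcoef_sum (R : comNzRingType) (I : finType) (P : pred I) (F : I -> fps R) n :
  fcoef (\sum_(i | P i) F i) n = \sum_(i | P i) fcoef (F i) n.
Proof. exact: (big_morph (fun f : fps R => fcoef f n)). Qed.

(** Multiplying by a series congruent to 1 modulo t^(M+1). *)
Lemma fcoef_mul1 (R : comNzRingType) M (f u : fps R) n : (n <= M)%N ->
  (forall i, (i <= M)%N -> fcoef u i = (i == 0%N)%:R) -> fcoef (f * u) n = fcoef f n.
Proof.
move=> nM u1; rewrite /= big_ord_recr/= subnn u1// mulr1 big1 ?add0r// => i _.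
rewrite u1 ?(leq_trans (leq_subr _ _))// subn_eq0 leqNgt ltn_ord mulr0//.
Qed.

Lemma fcoef_XnM (R : comNzRingType) c (f : fps R) n :
  fcoef (fps_X R ^+ c * f) n = if (c <= n)%N then fcoef f (n - c) else 0.
Proof.
rewrite /=; under eq_bigr do rewrite coef_fps_Xn.
case: leqP => cn; last first.
  by rewrite big1// => i _; rewrite ltn_eqF ?mul0r// (leq_trans (ltn_ord i)).
have cn1 : (c < n.+1)%N by [].
rewrite (bigD1 (Ordinal cn1))//= eqxx mul1r big1 ?addr0// => i ic.
by case: eqP => [e|_]; rewrite ?mul0r//; case/eqP: ic; exact: val_inj.
Qed.

(** Modulo t^(M+1) each factor 1 / (1 - t^w) is the polynomial
    1 + t^w + ... + t^(M w), and the product of these polynomials expands over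
    the functions [k]. *)
Lemma fcoef_inv_prod {r} (w : 'I_r -> nat) (R : comNzRingType) (P : pred 'I_r) M n :
  (forall s, 0 < w s)%N -> (n <= M)%N ->
  fcoef (\prod_(s | P s) (1 - fps_X R ^+ w s))^-1 n = #|supported_solutions w M P 0 n|%:R.
Proof.
move=> w0 nM; set den := \prod_(s | P s) _.
(* The denominator times the product of the truncated geometric series. *)
pose u : fps R := \prod_(s | P s) (1 - fps_X R ^+ (w s * M.+1)).
have u1 i : (i <= M)%N -> fcoef u i = (i == 0%N)%:R.
  move=> iM; rewrite /u; elim/big_ind: _ i iM => // [f g f1 g1 i iM|s _ i iM].
    by rewrite (@fcoef_mul1 _ M)// f1.
  have -> : fcoef (1 - fps_X R ^+ (w s * M.+1)) i
      = (i == 0%N)%:R - fcoef (fps_X R ^+ (w s * M.+1)) i by [].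
  rewrite coef_fps_Xn [(i == (_ * _)%N)]ltn_eqF ?subr0//.
  by rewrite (leq_trans (_ : i < M.+1)%N)// leq_pmull.
have denu : den \is a GRing.unit.
  by apply: rpred_prod => s _; exact: fps_unit_1subXn.
rewrite -(fcoef_mul1 _ M den^-1 u n nM u1).
have -> : den^-1 * u = \prod_(s | P s) \sum_(j < M.+1) fps_X R ^+ (w s * j).
  apply: (mulrI denu); rewrite mulVKr// -big_split/=; apply: eq_bigr => s _.
  rewrite exprM -[1 in LHS](expr1n _ M.+1) subrXX; congr (_ * _).
  by apply: eq_bigr => j _; rewrite expr1n mul1r exprM.
rewrite (big_distr_big ord0)/= fcoef_sum -sum1_card natr_sum.
rewrite big_mkcond/= [RHS]big_mkcond/=; apply: eq_bigr => k _.
rewrite prodrXr coef_fps_Xn [k \in supported_solutions _ _ _ _ _]inE add0n.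
have -> : (k \in pffun_on ord0 P (fun=> true)) = [forall s, (0 < k s)%N ==> P s].
  apply/pffun_onP/forallP => [[/fintype.subsetP h _] s|h].
    apply/implyP => ks; apply: h; rewrite inE; apply/eqP => e.
    by rewrite e in ks.
  split=> //; apply/fintype.subsetP => s; rewrite inE => ks.
  have /implyP := h s; apply; rewrite lt0n; apply: contraNneq ks => e.
  exact/eqP/val_inj.
case: forallP => // h; rewrite [in LHS]eq_sym.
rewrite (_ : \sum_(s | P s) _ = \sum_(s < r) k s * w s)%N.
  by case: eqP.
rewrite [RHS](bigID P)/= [X in (_ + X)%N]big1 ?addn0; last first.
  move=> s Ps; have := h s; rewrite (negbTE Ps) implybF -leqNgt leqn0 => /eqP->.
  by [].
by apply: eq_bigr => s _; rewrite mulnC.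
Qed.

Lemma fcoef_Xn_inv_prod {r} (w : 'I_r -> nat) (R : comNzRingType) (P : pred 'I_r) c n :
  (forall s, 0 < w s)%N ->
  fcoef (fps_X R ^+ c / \prod_(s | P s) (1 - fps_X R ^+ w s)) n
  = #|supported_solutions w n P c n|%:R.
Proof.
move=> w0; rewrite fcoef_XnM; case: leqP => cn.
  rewrite (fcoef_inv_prod w _ _ n)// ?leq_subr//; congr (_%:R).
  apply: eq_card => k; rewrite !inE add0n; congr (_ && _).
  by rewrite -(eqn_add2l c) subnKC.
rewrite (_ : #|_| = 0)%N//; apply: eq_card0 => k; rewrite !inE.
by apply/negbTE; rewrite negb_and; apply/orP; right; rewrite gtn_eqF// ltn_addr.
Qed.

End InverseProducts.

(** * Tiling the admissible bends by orthants *)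

Lemma hinge_weight_gt0 s : 0 < hinge_weight s.
Proof. by rewrite /hinge_weight half_gt0; nia. Qed.

(** Division with remainder where the remainder of a positive number is taken in
    1, ..., N rather than in 0, ..., N - 1. *)
Lemma digit_exists N e : 0 < N ->
  exists d k, [/\ e = d + k * N, d <= N & 0 < k -> 0 < d].
Proof.
move=> N0; case: e => [|e]; first by exists 0, 0.
(* [e] is now the predecessor of the number to be divided. *)
exists (e %% N).+1, (e %/ N); split=> //; last exact: ltn_pmod.
by rewrite {1}(divn_eq e N) addSn addnC.
Qed.

Definition bends {r} (d : {ffun 'I_r -> 'I_(r`!).+1}) (s : 'I_r) : nat := d s.

(** Each admissible vector of bends is uniquely [d s + k s * r`!] with [d] in the
    box [0, r!] and [k] supported where [d] is, and admissibility depends on [d]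
    only. *)
Lemma num_concave_partitionsE n r :
  num_concave_partitions n r =
  \sum_(d : {ffun 'I_r -> 'I_(r`!).+1} | lattice_corners r`! (bends d))
    #|supported_solutions hinge_weight n (fun s => 0 < bends d s)
        (staircase_weight r`! (bends d)) n|.
Proof.
set N := r`!; have N0 : 0 < N by exact: fact_gt0.
pose W (d : {ffun 'I_r -> 'I_N.+1}) : {set {ffun 'I_r -> 'I_n.+1}} :=
  supported_solutions hinge_weight n (fun s => 0 < bends d s) (staircase_weight N (bends d)) n.
pose B := [set p : {ffun 'I_r -> 'I_N.+1} * {ffun 'I_r -> 'I_n.+1} |
  lattice_corners N (bends p.1) && (p.2 \in W p.1)].
pose f (p : {ffun 'I_r -> 'I_N.+1} * {ffun 'I_r -> 'I_n.+1}) :=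
  staircase N (fun s => bends p.1 s + p.2 s * N).
transitivity #|B|; last first.
  rewrite -sum1dep_card -(pair_big_dep (fun d => lattice_corners N (bends d))
    (fun d k => k \in W d) (fun _ _ => 1))/=.
  by apply: eq_bigr => d _; rewrite sum1_card.
have BP p : p \in B -> [/\ lattice_corners N (bends p.1),
    forall s, 0 < p.2 s -> 0 < bends p.1 s &
    staircase_weight N (bends p.1) + \sum_(s < r) p.2 s * hinge_weight s = n].
  rewrite inE => /andP[cp]; rewrite inE => /andP[/forallP h /eqP ->].
  by split=> // s; apply/implyP.
apply: (card_fset_set_image B f).
- move=> [d k] [d' k'] /BP[/= cd kd _] /BP[/= cd' kd' _] /staircase_inj h.
  have {}h s : d s = d' s :> nat /\ k s = k' s :> nat.
    apply: (digit_unique N) => //; rewrite ?leq_ord//; [exact: kd|exact: kd'|].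
    by apply: h; rewrite ?lattice_cornersDM.
  by congr (_, _); apply/ffunP => s; apply: val_inj; have [] := h s.
- move=> p /BP[cp kp wp]; split; last exact: staircase_concave.
  rewrite -wp -staircase_weightDM//; exact: staircase_partition.
- move=> l [/partitionsP[dl l0 wl] cl].
  have [e ce el] := staircase_onto r l cl l0.
  have /choice[d /choice[k dk]] := fun s => digit_exists N (e s) N0.
  have ee : e = fun s => d s + k s * N by apply/funext => s; have [] := dk s.
  have kd s : 0 < k s -> 0 < d s by have [] := dk s.
  have wE : staircase_weight N d + \sum_(s < r) k s * hinge_weight s = n.
    by rewrite -staircase_weightDM// -ee -wl /staircase_weight el.
  have kn s : k s < n.+1.
    rewrite ltnS -wE (bigD1 s)//= addnCA (leq_trans _ (leq_addr _ _))//.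
    by rewrite leq_pmulr// hinge_weight_gt0.
  pose d' : {ffun 'I_r -> 'I_N.+1} := [ffun s => inord (d s)].
  pose k' : {ffun 'I_r -> 'I_n.+1} := [ffun s => inord (k s)].
  have d'E : bends d' = d.
    by apply/funext => s; rewrite /bends ffunE inordK// ltnS; have [] := dk s.
  have k'E s : k' s = k s :> nat by rewrite ffunE inordK.
  exists (d', k').
    rewrite inE/= d'E; apply/andP; split.
      by rewrite ee lattice_cornersDM in ce.
    rewrite inE d'E; apply/andP; split.
      by apply/forallP => s; rewrite k'E; apply/implyP/kd.
    by rewrite -[X in _ == X]wE; apply/eqP; congr (_ + _); apply: eq_bigr => s _; rewrite k'E.
  rewrite /f/= d'E -el ee; congr staircase; apply/funext => s; by rewrite k'E.
Qed.

Definition tail_sum {r} (k : 'I_r -> nat) (x : nat) := \sum_(s < r | x <= s) k s.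

(** [k s] is the number of columns of height [s.+1] in the Ferrers diagram, that
    is, [l s - l s.+1] for the partition [l]. *)
Lemma num_partitionsE n r :
  num_partitions n r = #|supported_solutions (fun s : 'I_r => s.+1) n xpredT 0 n|.
Proof.
have tailS (k : 'I_r -> nat) (s : 'I_r) : tail_sum k s = k s + tail_sum k s.+1.
  rewrite /tail_sum (bigD1 s)//=; congr (_ + _); apply: eq_bigl => t.
  by rewrite ltn_neqAle eq_sym andbC.
have tail0 (k : 'I_r -> nat) x : r <= x -> tail_sum k x = 0.
  by move=> rx; rewrite /tail_sum big_pred0// => s; apply/negbTE; rewrite -ltnNge (leq_trans _ rx).
have tailW (k : 'I_r -> nat) : \sum_(x < r) tail_sum k x = \sum_(s < r) k s * s.+1.
  rewrite (exchange_big_dep xpredT)//=; apply: eq_bigr => s _.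
  by rewrite -(big_ord_widen r (fun=> k s) (ltn_ord s)) sum_nat_const card_ord mulnC.
apply: (card_fset_set_image _ (fun k : {ffun 'I_r -> 'I_n.+1} => tail_sum (fun s => k s))).
- move=> k k' _ _ e; apply/ffunP => s; apply: val_inj => /=.
  have := tailS (fun s => k s) s; rewrite e tailS /=; lia.
- move=> k; rewrite inE => /andP[_ /eqP wk]; apply/partitionsP; split.
  + move=> x; have [xr|rx] := ltnP x r; first by rewrite (tailS _ (Ordinal xr)) leq_addl.
    by rewrite tail0// leqW.
  + exact: tail0.
  + by rewrite tailW -[RHS]wk.
- move=> l /partitionsP[dl l0 wl].
  pose k (s : 'I_r) := l s - l s.+1.
  have kl x : tail_sum k x = l x.
    have [m] := ubnP (r - x); elim: m x => // m IHm x xm.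
    have [rx|xr] := leqP r x; first by rewrite tail0// l0.
    by rewrite (tailS k (Ordinal xr)) /k/= IHm ?subnK//; lia.
  have wk : \sum_(s < r) k s * s.+1 = n.
    by rewrite -tailW -wl; apply: eq_bigr => s _.
  have kn s : k s < n.+1.
    by rewrite ltnS -wk (bigD1 s)//= (leq_trans _ (leq_addr _ _))// leq_pmulr.
  have k'E : (fun s => [ffun s => inord (k s) : 'I_n.+1] s : nat) = k.
    by apply/funext => s; rewrite ffunE inordK.
  exists [ffun s => inord (k s)]; last by rewrite k'E; exact/funext.
  rewrite inE; apply/andP; split; first by apply/forallP => s; rewrite implybT.
  rewrite add0n -[X in _ == X]wk; apply/eqP; apply: eq_bigr => s _.
  by rewrite -[in RHS]k'E.
Qed.

Definition saturated {r} (d : {ffun 'I_r -> 'I_(r`!).+1}) : bool :=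
  [forall s, (d s == 0 :> nat) || (d s == r`! :> nat)].

Definition supp_ind {r} (d : {ffun 'I_r -> 'I_(r`!).+1}) (s : 'I_r) : nat := 0 < bends d s.

Lemma sum_supp_ind {r} (d : {ffun 'I_r -> 'I_(r`!).+1}) (F : 'I_r -> nat) :
  \sum_(s < r) supp_ind d s * F s = \sum_(s < r | 0 < bends d s) F s.
Proof.
rewrite [RHS]big_mkcond; apply: eq_bigr => s _.
by rewrite /supp_ind; case: ifP; rewrite ?mul1n.
Qed.

Lemma saturatedE {r} (d : {ffun 'I_r -> 'I_(r`!).+1}) : saturated d ->
  bends d = fun s => 0 + supp_ind d s * r`!.
Proof.
move=> /forallP h; apply/funext => s; rewrite /supp_ind/bends add0n.
by case/orP: (h s) => /eqP ->; rewrite ?fact_gt0 ?mul1n.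
Qed.

Lemma hinge_cst0 {r} x : @hinge r (fun=> 0) x = 0.
Proof. by apply: big1 => s _; rewrite mul0n. Qed.

Lemma saturated_corners {r} (d : {ffun 'I_r -> 'I_(r`!).+1}) : saturated d ->
  lattice_corners r`! (bends d).
Proof.
move=> /saturatedE ->; rewrite /lattice_corners !hingeDM hinge_cst0 dvdn_mull//=.
by apply/forallP => s; rewrite hingeDM hinge_cst0 dvdn_mull// implybT.
Qed.

Lemma saturated_weight {r} (d : {ffun 'I_r -> 'I_(r`!).+1}) : saturated d ->
  staircase_weight r`! (bends d) = \sum_(s < r | 0 < bends d s) hinge_weight s.
Proof.
move=> sd; rewrite [in LHS]saturatedE// staircase_weightDM ?fact_gt0// sum_supp_ind.
rewrite /staircase_weight big1 ?add0n// => x _; rewrite /staircase hinge_cst0.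
by rewrite /ceil_div add0n divn_small// prednK ?fact_gt0.
Qed.

(** Each value of the staircase is at most the value of the integral function with
    bends 1 on the support.  At 0 the function with bends [d] takes an integral
    value, so rounding up loses nothing there and the inequality is strict. *)
Lemma unsaturated_weight {r} (d : {ffun 'I_r -> 'I_(r`!).+1}) :
  lattice_corners r`! (bends d) -> ~~ saturated d ->
  staircase_weight r`! (bends d) < \sum_(s < r | 0 < bends d s) hinge_weight s.
Proof.
move=> /andP[c0 _] /forallPn[s]; rewrite negb_or => /andP[ds0 dsN].
set N := r`! in c0 dsN *; have N0 : 0 < N by exact: fact_gt0.
have dk t : bends d t <= supp_ind d t * N.
  by rewrite /supp_ind; case: posnP => [->//|_]; rewrite mul1n -ltnS; exact: ltn_ord.
have le x : staircase N (bends d) x <= hinge (supp_ind d) x.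
  rewrite ceil_div_le// /hinge big_distrl/=; apply: leq_sum => t _.
  by rewrite mulnAC leq_mul2r dk orbT.
have lt0 : staircase N (bends d) 0 < hinge (supp_ind d) 0.
  rewrite -(ltn_pmul2r N0) ceil_divK// !hinge0E big_distrl/=.
  rewrite (bigD1 s)//= [ltnRHS](bigD1 s)//= -addSn leq_add//; last first.
    by apply: leq_sum => t _; rewrite mulnAC leq_mul2r dk orbT.
  rewrite mulnAC ltn_pmul2r// /supp_ind lt0n ds0 mul1n.
  by rewrite ltn_neqAle dsN -ltnS; exact: ltn_ord.
rewrite -sum_supp_ind -sum_hinge /staircase_weight.
have r0 : 0 < r by exact: leq_ltn_trans (ltn_ord s).
rewrite (bigD1 (Ordinal r0))//= [ltnRHS](bigD1 (Ordinal r0))//= -addSn leq_add//.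
exact: leq_sum.
Qed.

(** With a bend at every point the function is integral everywhere, hence so are
    its second differences. *)
Lemma full_support {r} (d : {ffun 'I_r -> 'I_(r`!).+1}) :
  lattice_corners r`! (bends d) -> (forall s, 0 < bends d s) -> d = [ffun=> ord_max].
Proof.
move=> /andP[c0 /forallP c] d0; apply/ffunP => s; rewrite ffunE; apply: val_inj => /=.
have cc x : r`! %| hinge (bends d) x.
  case: x => [//|x]; have [xr|rx] := ltnP x r; last by rewrite hinge_out// leqW.
  by have /implyP/(_ (d0 _)) := c (Ordinal xr).
apply/eqP; rewrite eqn_leq -ltnS ltn_ord/=; apply: dvdn_leq; first exact: d0.
have c2 : r`! %| 2 * hinge (bends d) s.+1 by rewrite dvdn_mull.
by move: (dvdn_addr (bends d s) c2); rewrite -hinge_diff2 dvdn_add// => <-.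
Qed.

(** * Growth of the number of solutions *)

Definition num_solutions (w : nat -> nat) (r n : nat) : nat :=
  #|supported_solutions (fun s : 'I_r => w s) n xpredT 0 n|.

Lemma num_solutionsE (R : comNzRingType) (w : nat -> nat) r n : (forall s, 0 < w s) ->
  fcoef (\prod_(s < r) (1 - fps_X R ^+ w s))^-1%R n = ((num_solutions w r n)%:R)%R.
Proof. by move=> w0; apply: fcoef_inv_prod. Qed.

Lemma num_solutions0 w n : num_solutions w 0 n = (n == 0).
Proof.
rewrite /num_solutions; case: eqP => [->|/eqP n0].
  rewrite (_ : supported_solutions _ _ _ _ _ = [set: {ffun 'I_0 -> 'I_1}]%SET)
    ?cardsT ?card_ffun ?card_ord//.
  by apply/setP => k; rewrite !inE big_ord0 andbT; apply/forallP => -[].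
apply: eq_card0 => k; rewrite !inE big_ord0 addn0 eq_sym (negbTE n0) andbF//.
Qed.

Lemma num_solutionsS (w : nat -> nat) r n : (forall s, 0 < w s) ->
  num_solutions w r.+1 n
  = num_solutions w r n + (if w r <= n then num_solutions w r.+1 (n - w r) else 0).
Proof.
move=> w0; apply/eqP; rewrite -(eqr_nat int) natrD -subr_eq.
rewrite [X in (_ - X)%R](_ : _ = fcoef (fps_X int ^+ w r *
    (\prod_(s < r.+1) (1 - fps_X int ^+ w s))^-1)%R n); last first.
  by rewrite fcoef_XnM; case: ifP => // _; rewrite num_solutionsE.
rewrite -!num_solutionsE// big_ord_recr/=; set f := (\prod_(s < r) _)%R; set g := (1 - _)%R.
have fu : f \is a GRing.unit by apply: rpred_prod => s _; exact: fps_unit_1subXn.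
have gu : g \is a GRing.unit by exact: fps_unit_1subXn.
have -> : (f^-1 = (f * g)^-1 - fps_X int ^+ w r * (f * g)^-1)%R.
  by rewrite -[X in (X - _)%R]mul1r -mulrBl -/g invrM// mulrCA mulrA mulVr// mul1r.
by [].
Qed.

(** The mean value bound for the power function, from above. *)
Lemma expn_chord_le y w r : (y + w) ^ r.+1 <= y ^ r.+1 + r.+1 * w * (y + w) ^ r.
Proof.
elim: r => [|r IH]; first by rewrite !expn1 expn0 mul1n muln1.
rewrite [_ ^ r.+2]expnS mulnDl (leq_trans (leq_add (leq_mul (leqnn y) IH) (leqnn _)))//.
by rewrite mulnDr -expnS -addnA leq_add2l [r.+2 * w]mulSn [in leqRHS]mulnDl addnC
  leq_add2l mulnCA leq_mul2l [in leqRHS]expnS leq_mul2r leq_addr !orbT.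
Qed.

(** The first two terms of the binomial expansion. *)
Lemma expn_chord_ge y w r : y ^ r.+1 + r.+1 * w * y ^ r <= (y + w) ^ r.+1.
Proof.
elim: r => [|r IH]; first by rewrite !expn1 expn0 mul1n muln1.
rewrite [(y + w) ^ _]expnS (leq_trans _ (leq_mul (leqnn (y + w)) IH))//.
rewrite mulnDl !mulnDr -expnS [y * (_ * _)]mulnCA -expnS mulnA.
rewrite -addnA leq_add2l [r.+2 * w]mulSn mulnDl addnC leq_add2l.
by rewrite -[X in X <= _]addn0 leq_add.
Qed.

(** Up to the factor r! w_0 ... w_r, the bounds are volumes of simplices.  The
    induction adds one weight v at a time: by [num_solutionsS] the count at n is a sum
    along the progression n, n - v, n - 2 v, ..., which is compared with a power
    of one degree more by [expn_chord_le] and [expn_chord_ge]. *)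
Lemma num_solutions_bounds (w : nat -> nat) r n : (forall s, 0 < w s) -> w 0 = 1 ->
  n ^ r <= r`! * \prod_(s < r.+1) w s * num_solutions w r.+1 n
        <= (n + \sum_(s < r.+1) w s) ^ r.
Proof.
move=> w0 w01; elim: r n => [|r IHr] n.
  rewrite big_ord1 big_ord_recl w01 !mul1n !expn0.
  suff -> : num_solutions w 1 n = 1 by [].
  by elim: n => [|n IHn]; rewrite num_solutionsS// num_solutions0 w01//= subn1 IHn.
rewrite factS [\prod_(s < r.+2) _]big_ord_recr [\sum_(s < r.+2) _]big_ord_recr.
rewrite [_ (\prod_(s < r.+1) _) _]/= [_ (\sum_(s < r.+1) _) _]/=.
set K := \prod_(s < r.+1) w s in IHr *; set S := \sum_(s < r.+1) w s in IHr *.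
have w1 := w0 r.+1; move: (w r.+1) w1 (num_solutionsS w r.+1) => v v0 rec.
elim/ltn_ind: n => n IHn; rewrite rec//; case/andP: (IHr n) => lo up.
set c := num_solutions w r.+1 n in lo up *.
have E x : r.+1 * r`! * (K * v) * x = r.+1 * v * (r`! * K * x) by nia.
rewrite mulnDr E; have [vn|nv] := leqP v n.
  have nvn : n - v < n by rewrite ltn_subrL v0 (leq_trans v0).
  case/andP: (IHn _ nvn) => lo' up'.
  apply/andP; split.
    have := expn_chord_le (n - v) v r; rewrite subnK// => /leq_trans; apply.
    by rewrite addnC leq_add// leq_mul2l lo orbT.
  have := expn_chord_ge (n + S) v r; rewrite addnA; apply: leq_trans.
  rewrite addnC leq_add//; last by rewrite leq_mul2l up orbT.
  by rewrite (leq_trans up')// (_ : n - v + _ = n + S)//; lia.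
rewrite muln0 addn0; apply/andP; split.
  rewrite expnS (@leq_trans (r.+1 * v * n ^ r))//; last by rewrite leq_mul2l lo orbT.
  by rewrite leq_mul2r (leq_trans (ltnW nv)) ?leq_pmull// orbT.
have := expn_chord_ge (n + S) v r; rewrite addnA; apply: leq_trans.
by rewrite (leq_trans _ (leq_addl _ _))// leq_mul2l up orbT.
Qed.

Local Open Scope classical_set_scope.
Local Open Scope ring_scope.

(** * The numerator of the generating function *)

Fact fps_of_poly_zmod_morphism (R : comNzRingType) : zmod_morphism (@fps_of_poly R).
Proof. by move=> p q; apply: fps_eq => n /=; rewrite coefB. Qed.
Fact fps_of_poly_monoid_morphism (R : comNzRingType) : monoid_morphism (@fps_of_poly R).
Proof.
split=> [|p q]; apply: fps_eq => n /=; first by rewrite coef1.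
by rewrite coefM.
Qed.
HB.instance Definition _ (R : comNzRingType) := GRing.isZmodMorphism.Build {poly R} (fps R)
  (@fps_of_poly R) (fps_of_poly_zmod_morphism R).
HB.instance Definition _ (R : comNzRingType) := GRing.isMonoidMorphism.Build {poly R} (fps R)
  (@fps_of_poly R) (fps_of_poly_monoid_morphism R).

Definition concave_numer (r : nat) : {poly int} :=
  \sum_(d : {ffun 'I_r -> 'I_(r`!).+1} | lattice_corners r`! (bends d))
    'X^(staircase_weight r`! (bends d)) *
    \prod_(s < r | ~~ (0 < bends d s)%N) (1 - 'X^(hinge_weight s)).

(** Each orthant contributes a shifted product of geometric series; bringing all
    of them to the common denominator leaves the factors outside the support in
    the numerator. *)
Lemma PC_rational r :
  PC r = fps_of_poly (concave_numer r) / \prod_(s < r) (1 - fps_X int ^+ hinge_weight s).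
Proof.
have unit_prod P : \prod_(s < r | P s) (1 - fps_X int ^+ hinge_weight s) \is a GRing.unit.
  by apply: rpred_prod => s _; apply: fps_unit_1subXn; exact: hinge_weight_gt0.
apply: (canRL (mulrK (unit_prod xpredT))).
have -> : PC r = \sum_(d : {ffun 'I_r -> 'I_(r`!).+1} | lattice_corners r`! (bends d))
    (fps_X int ^+ staircase_weight r`! (bends d)
     / \prod_(s < r | (0 < bends d s)%N) (1 - fps_X int ^+ hinge_weight s)).
  apply: fps_eq => n; rewrite fcoef_sum [LHS]/= -natz num_concave_partitionsE natr_sum.
  by apply: eq_bigr => d _; rewrite fcoef_Xn_inv_prod// => s; exact: hinge_weight_gt0.
rewrite /concave_numer rmorph_sum mulr_suml; apply: eq_bigr => d _.
rewrite rmorphM rmorphXn rmorph_prod/= -/(fps_X int).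
rewrite [X in _ * X](bigID (fun s : 'I_r => (0 < bends d s)%N))/=.
rewrite mulrA divrK//; congr (_ * _); apply: eq_bigr => s _.
by rewrite rmorphB rmorph1 rmorphXn.
Qed.

(** At 1 each factor 1 - t^w vanishes, so only the terms without such a factor
    remain, and [full_support] leaves a single one. *)
Lemma concave_numer1 r : (concave_numer r).[1] = 1.
Proof.
pose dN : {ffun 'I_r -> 'I_(r`!).+1} := [ffun=> ord_max].
have dN0 s : (0 < bends dN s)%N by rewrite /bends ffunE fact_gt0.
rewrite horner_sum (bigD1 dN)/=; last first.
  by apply/saturated_corners/forallP => s; rewrite ffunE eqxx orbT.
rewrite hornerM hornerXn expr1n mul1r big_pred0 => [|s]; last by rewrite dN0.
rewrite hornerE big1 ?addr0// => d /andP[cd /eqP dN1].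
have [s ds|d0] := pickP (fun s => ~~ (0 < bends d s)%N); last first.
  by case: dN1; apply: full_support => // s; have /negbFE := d0 s.
rewrite hornerM horner_prod (bigD1 s)//=.
by rewrite !hornerE !expr1n subrr /= mulr0 mul0r.
Qed.

Lemma size_prod_1subXn (I : finType) (P : pred I) (w : I -> nat) :
  (size (\prod_(s | P s) (1 - 'X^(w s)) : {poly int})%R <= (\sum_(s | P s) w s).+1)%N.
Proof.
elim/big_rec2: _ => [|s n p _ IH]; first by rewrite size_poly1.
rewrite (leq_trans (size_polyMleq _ _))// -ltnS.
have : (size (1 - 'X^(w s) : {poly int})%R <= (w s).+1)%N.
  by rewrite (leq_trans (size_polyD _ _))// size_polyN size_polyXn size_poly1 geq_max leqnn.
lia.
Qed.

(** The vectors with entries 0 and [r`!] correspond to subsets of the indices, and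
    the sum is the expansion of the product over s of t^w_s + (1 - t^w_s). *)
Lemma sum_saturated r :
  \sum_(d : {ffun 'I_r -> 'I_(r`!).+1} | saturated d)
    'X^(staircase_weight r`! (bends d)) *
    \prod_(s < r | ~~ (0 < bends d s)%N) (1 - 'X^(hinge_weight s)) = 1 :> {poly int}.
Proof.
pose Q (j : 'I_(r`!).+1) := (j == 0 :> nat)%N || (j == r`! :> nat)%N.
pose F (s : 'I_r) (j : 'I_(r`!).+1) : {poly int} :=
  if (0 < j)%N then 'X^(hinge_weight s) else 1 - 'X^(hinge_weight s).
have sF s : \sum_(j | Q j) F s j = 1.
  rewrite (bigD1 ord0)//= (bigD1 ord_max)/=; last first.
    by rewrite /Q eqxx orbT -val_eqE/= -lt0n fact_gt0.
  rewrite big1 => [|j /andP[/andP[/orP[] /eqP j0]]]; first by rewrite addr0 /F/= fact_gt0 subrK.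
    by rewrite -val_eqE/= j0.
  by move=> _; rewrite -val_eqE/= j0 eqxx.
transitivity (\prod_(s < r) \sum_(j | Q j) F s j); last by rewrite big1.
rewrite bigA_distr_big; apply: eq_big => [d|d sd].
  by apply/forallP/ffun_onP.
rewrite saturated_weight// -prodrXr [RHS](bigID (fun s => (0 < bends d s)%N))/=.
by congr (_ * _); apply: eq_bigr => s ds; rewrite /F ?ds// (negbTE ds).
Qed.

(** The saturated terms, whose degrees are too large, add up to 1; every other
    term is small by [unsaturated_weight]. *)
Lemma size_concave_numer r : (0 < r)%N ->
  (size (concave_numer r) <= \sum_(s < r) hinge_weight s)%N.
Proof.
move=> r0; rewrite /concave_numer (bigID saturated)/=.
rewrite (eq_bigl saturated); last first.
  by move=> d; apply/andP/idP => [[]//|sd]; split=> //; exact: saturated_corners.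
rewrite sum_saturated (leq_trans (size_polyD _ _))// geq_max size_poly1.
apply/andP; split.
  by rewrite (bigD1 (Ordinal r0))//= ltn_addr// hinge_weight_gt0.
rewrite (leq_trans (size_sum _ _ _))//; apply/bigmax_leqP => d /andP[cd sd].
rewrite (leq_trans (size_polyMleq _ _))// size_polyXn.
have := unsaturated_weight d cd sd.
have := size_prod_1subXn _ (fun s : 'I_r => ~~ (0 < bends d s)%N) (fun s => hinge_weight s).
rewrite [X in _ -> _ -> (_ <= X)%N](bigID (fun s : 'I_r => (0 < bends d s)%N))/=.
by move=> h1 h2; have := leq_add h2 h1; rewrite addSn addnS ltnS.
Qed.

Lemma natr_hinge_weight (F : numFieldType) s :
  (hinge_weight s)%:R = (s.+1 * s.+2)%:R / 2 :> F.
Proof.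
have : (hinge_weight s * 2 = s.+1 * s.+2)%N.
  by rewrite muln2 /hinge_weight even_halfK// oddM /= negbK; case: odd.
by move=> <-; rewrite natrM mulfK ?pnatr_eq0.
Qed.

Lemma natr_sum_hinge_weight r :
  (\sum_(s < r) hinge_weight s)%:R = r%:R ^+ 3 / 6 + r%:R ^+ 2 / 2 + r%:R / 3 :> rat.
Proof.
elim: r => [|r IHr]; first by rewrite big_ord0; field.
by rewrite big_ord_recr/= natrD IHr natr_hinge_weight natrM -!natr1; field.
Qed.

(** * Limits *)

Lemma cvg_shift_ratio (R : realType) (a b : nat) :
  ((n + a)%:R / (n + b.+1)%:R : R) @[n --> \oo] --> (1 : R).
Proof.
have -> : (fun n => (n + a)%:R / (n + b.+1)%:R : R)
    = (fun n => 1 + (a%:R - b.+1%:R) * harmonic (n + b)%N).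
  apply/funext => n; rewrite /harmonic/= -addnS !natrD.
  by field; rewrite nat1r -natrD pnatr_eq0 addnS.
rewrite -[X in _ --> X]addr0; apply: cvgD; first exact: cvg_cst.
rewrite -[X in _ --> X](mulr0 (a%:R - b.+1%:R)); apply: cvgM; first exact: cvg_cst.
by rewrite (cvg_shiftn b (@harmonic R)); exact: cvg_harmonic.
Qed.

Lemma num_solutions_cvg (R : realType) (w : nat -> nat) r i m :
  (forall s, 0 < w s)%N -> w 0%N = 1%N ->
  ((num_solutions w r.+1 (n + i))%:R / (n + m.+1)%:R ^+ r : R) @[n --> \oo] -->
  ((r`! * \prod_(s < r.+1) w s)%:R^-1 : R).
Proof.
move=> w0 w01; set K := (r`! * _)%N; set S := (\sum_(s < r.+1) w s)%N.
have K0 : 0 < K%:R :> R by rewrite ltr0n muln_gt0 fact_gt0 prodn_gt0.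
have lim a : (((n + a)%:R / (n + m.+1)%:R) ^+ r / K%:R : R) @[n --> \oo] --> (K%:R^-1 : R).
  rewrite -[X in _ --> X]mul1r; apply: cvgM; last exact: cvg_cst.
  elim: r {K S K0} => [|k IHk]; first exact: cvg_cst.
  have := cvgM (cvg_shift_ratio R a m) IHk; rewrite mulr1 => /(_ _) h.
  by apply: cvg_trans h; apply: near_eq_cvg; near=> n; rewrite exprS.
apply: (squeeze_cvgr _ (lim i) (lim (i + S)%N)); near=> n.
have x0 : 0 < (n + m.+1)%:R ^+ r :> R by rewrite exprn_gt0// ltr0n addnS.
have /andP[lo up] := num_solutions_bounds w r (n + i) w0 w01.
rewrite !expr_div_n ![_ / _ / K%:R]mulrAC !ler_pM2r ?invr_gt0//.
rewrite ler_pdivrMr// ler_pdivlMr// mulrC -!natrX -natrM !ler_nat addnA.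
by rewrite lo.
Unshelve. all: by end_near. Qed.

(** Each coefficient is a combination, with the coefficients of the numerator, of a
    fixed number of consecutive values of the counting function; all of these
    have the same leading term, and the coefficients add up to 1.  The index is
    shifted by the size of the numerator to keep the arguments nonnegative. *)
Lemma num_concave_cvg (R : realType) r :
  ((num_concave_partitions (n + size (concave_numer r.+1)) r.+1)%:R
    / (n + (size (concave_numer r.+1)).+1)%:R ^+ r : R) @[n --> \oo] -->
  ((r`! * \prod_(s < r.+1) hinge_weight s)%:R^-1 : R).
Proof.
set Q := concave_numer r.+1; set J := size Q; set K := (r`! * _)%N.
have pcE n : (num_concave_partitions (n + J) r.+1)%:R
    = \sum_(i < J) (Q`_i)%:~R * (num_solutions hinge_weight r.+1 (n + (J - i)))%:R :> R.
  have := congr1 (fun f => fcoef f (n + J)) (PC_rational r.+1).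
  rewrite [LHS]/= -natz => /(congr1 (fun z : int => z%:~R : R)); rewrite mulrz_nat => ->.
  rewrite /= rmorph_sum/= (big_ord_widen (n + J).+1 (fun i =>
    (Q`_i)%:~R * (num_solutions hinge_weight r.+1 (n + (J - i)))%:R)); last first.
    by rewrite leqW// leq_addl.
  rewrite [RHS]big_mkcond/=; apply: eq_bigr => i _.
  case: ltnP => iJ; last by rewrite nth_default// mul0r.
  by rewrite rmorphM/= num_solutionsE ?mulrz_nat ?addnBA// 1?ltnW//.
have Q1 : \sum_(i < J) (Q`_i)%:~R = 1 :> R.
  rewrite -rmorph_sum/= -[RHS](rmorph1 (intmul (1 : R))) -(concave_numer1 r.+1) horner_coef.
  by congr (_%:~R); apply: eq_bigr => i _; rewrite expr1n mulr1.
rewrite (_ : K%:R^-1 = \sum_(i < J) (Q`_i)%:~R * K%:R^-1 :> R); last first.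
  by rewrite -mulr_suml Q1 mul1r.
have -> : (fun n => (num_concave_partitions (n + J) r.+1)%:R / (n + J.+1)%:R ^+ r : R)
    = (fun n => \sum_(i < J) (Q`_i)%:~R *
        ((num_solutions hinge_weight r.+1 (n + (J - i)))%:R / (n + J.+1)%:R ^+ r)).
  by apply/funext => n; rewrite pcE mulr_suml; apply: eq_bigr => i _; rewrite mulrA.
apply: cvg_big => [|i _]; first exact: add_continuous; apply: cvgM; first exact: cvg_cst.
by apply: num_solutions_cvg => // s; exact: hinge_weight_gt0.
Qed.

Lemma num_partitions_cvg (R : realType) r i m :
  ((num_partitions (n + i) r.+1)%:R / (n + m.+1)%:R ^+ r : R) @[n --> \oo] -->
  ((r`! * r.+1`!)%:R^-1 : R).
Proof.
rewrite [r.+1`!]fact_prod big_add1 big_mkord.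
under eq_fun do rewrite num_partitionsE.
exact: (num_solutions_cvg R succn).
Qed.

Theorem corollary11 (R : realType) (r : nat) (hr : (0 < r)%N) :
  (exists Q : {poly int},
     [/\ PC r = fps_of_poly Q
                / \prod_(1 <= i < r.+1) (1 - fps_X int ^+ (i * i.+1)./2),
         Q.[1] = 1 &
         ((size Q).-1%:R < r%:R ^+ 3 / 6 + r%:R ^+ 2 / 2 + r%:R / 3 :> rat)])
  /\
  ((num_concave_partitions n r)%:R / (num_partitions n r)%:R : R) @[n --> \oo] -->
    (r`!%:R / \prod_(1 <= i < r.+1) ((i * i.+1)%:R / 2) : R).
Proof.
split.
  exists (concave_numer r); rewrite big_add1 big_mkord; split.
  - exact: PC_rational.
  - exact: concave_numer1.
  - rewrite -natr_sum_hinge_weight ltr_nat.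
    have D0 : (0 < \sum_(s < r) hinge_weight s)%N.
      by rewrite (bigD1 (Ordinal hr))//= ltn_addr// hinge_weight_gt0.
    by have := size_concave_numer r hr; case: (size _).
case: r hr => // r _; pose J := size (concave_numer r.+1).
have fact0 n : n`!%:R != 0 :> R by rewrite pnatr_eq0 -lt0n fact_gt0.
have W0 : (\prod_(s < r.+1) hinge_weight s)%:R != 0 :> R.
  by rewrite pnatr_eq0 -lt0n prodn_gt0// => s; exact: hinge_weight_gt0.
have -> : r.+1`!%:R / \prod_(1 <= i < r.+2) ((i * i.+1)%:R / 2)
    = (r`! * \prod_(s < r.+1) hinge_weight s)%:R^-1 / (r`! * r.+1`!)%:R^-1 :> R.
  rewrite big_add1 big_mkord.
  have -> : \prod_(s < r.+1) ((s.+1 * s.+2)%:R / 2) = (\prod_(s < r.+1) hinge_weight s)%:R :> R.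
    by rewrite natr_prod; apply: eq_bigr => s _; rewrite natr_hinge_weight.
  rewrite 2!(natrM R r`!); move: (fact0 r) (fact0 r.+1) W0.
  move: (r.+1`!%:R : R) (r`!%:R : R) ((\prod_(s < r.+1) _)%:R : R) => u v p v0 u0 p0.
  by field; rewrite v0 u0 p0.
have K0 : (r`! * r.+1`!)%:R^-1 != 0 :> R by rewrite invr_eq0 natrM mulf_neq0.
have := cvgM (num_concave_cvg R r) (cvgV K0 (num_partitions_cvg R r J J)).
set q := _ \* _ => /(_ _) h; rewrite -(cvg_shiftn J).
suff -> : (fun n => (num_concave_partitions (n + J) r.+1)%:R
    / (num_partitions (n + J) r.+1)%:R : R) = q by exact: h.
by apply/funext => n; rewrite /q/= -/J invf_div mulrA divfK//.
Qed.
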